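(* Let $A\in\mathrm{GL}(2,\mathbb R)$, let $u\in\mathbb R^2$ be a unit vector and $t\in\mathbb R$. Let $F^*_{t,u}$ be the extended rescaled Poincaré map under moving orthogonal frame of the linear vector field $\dot x=Ax$, and $\tau=\tau(y)$ the associated time function. Then $$\frac{d^2F^*_{t,u}}{dy^2}(0)=2\,\frac{\big\langle Ae^{tA}(Au)^\perp,(Ae^{tA}u)^\perp\big\rangle}{\big\langle Ae^{tA}u,Ae^{tA}u\big\rangle}\,\frac{d\tau}{dy}(0)+\frac{\big\langle A^2e^{tA}u,(Ae^{tA}u)^\perp\big\rangle}{\big\langle Ae^{tA}u,Ae^{tA}u\big\rangle}\Big(\frac{d\tau}{dy}(0)\Big)^2 .$$
   Context: For $w\in\mathbb R^2$, $w^\perp$ is the rotation of $w$ by $\pi/2$. For $y\in\mathbb R$ near $0$, $\tau(y)$ is the smooth function with $\tau(0)=0$ determined by $$\Big\langle \frac{e^{(\tau(y)+t)A}\,y(Au)^\perp}{\|Ae^{tA}u\|}+\frac{e^{(\tau(y)+t)A}u-e^{tA}u}{\|Ae^{tA}u\|},\ \frac{Ae^{tA}u}{\|Ae^{tA}u\|}\Big\rangle=0 .$$ The extended rescaled Poincaré map $P^*$ at $(t,u)$ is $$P^*\Big(t,u,0,y\tfrac{(Au)^\perp}{\|Au\|}\Big)=\frac{e^{(\tau(y)+t)A}\,y(Au)^\perp}{\|Ae^{tA}u\|}+\frac{e^{(\tau(y)+t)A}u-e^{tA}u}{\|Ae^{tA}u\|},$$ and the map under moving orthogonal frame, $F^*_{t,u}(y)\in\mathbb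 R$ (for $y$ near $0$), is defined by $$P^*\Big(t,u,0,y\tfrac{(Au)^\perp}{\|Au\|}\Big)=F^*_{t,u}(y)\,\frac{(Ae^{tA}u)^\perp}{\|(Ae^{tA}u)^\perp\|}.$$ *)

(* Defs.v *)
From HB Require Import structures.
From mathcomp Require Import all_boot all_order all_algebra.
From mathcomp Require Import all_classical all_reals all_analysis.

Set Implicit Arguments.
Unset Strict Implicit.
Unset Printing Implicit Defensive.

Import Order.TTheory GRing.Theory Num.Theory.
Import numFieldNormedType.Exports.

Local Open Scope classical_set_scope.
Local Open Scope ring_scope.

Definition expmx (R : realType) (n : nat) (A : 'M[R]_n.+1) : 'M[R]_n.+1 :=
  lim (series (fun k => (k`!%:R)^-1 *: A ^+ k) @ \oo).

Definition dot (R : realType) (v w : 'cV[R]_2) : R := \sum_(i < 2) v i 0 * w i 0.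

(* Euclidean norm; the library norm `|v| on matrices is the sup norm. *)
Definition enorm (R : realType) (v : 'cV[R]_2) : R := Num.sqrt (dot v v).

(* Counterclockwise rotation by pi/2: (w0, w1) |-> (- w1, w0). *)
Definition perp (R : realType) (w : 'cV[R]_2) : 'cV[R]_2 :=
  \col_i (if i == 0 then - w 1 0 else w 0 0).

Section PoincareMap.
Variables (R : realType) (A : 'M[R]_2) (t : R) (u : 'cV[R]_2).

Definition flow (s : R) : 'M[R]_2 := expmx (s *: A).

(* The value of the vector field at the base point: A e^{tA} u. *)
Definition baseVelocity : 'cV[R]_2 := A *m flow t *m u.

(* P^*(t, u, 0, y (Au)^perp / |Au|) as a function of y, the time function tau
   being given. *)
Definition poincareExt (tau : R -> R) (y : R) : 'cV[R]_2 :=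
  (enorm baseVelocity)^-1 *: (flow (tau y + t) *m (y *: perp (A *m u)))
  + (enorm baseVelocity)^-1 *: (flow (tau y + t) *m u - flow t *m u).

(* tau only matters near 0: smoothness and the orthogonality relation are
   required on a neighbourhood of 0. *)
Definition isTimeFunction (tau : R -> R) : Prop :=
  [/\ tau 0 = 0,
      \forall y \near (0 : R), forall n, derivable (tau^`(n))%classic y 1 &
      \forall y \near (0 : R),
        dot (poincareExt tau y) ((enorm baseVelocity)^-1 *: baseVelocity) = 0].

(* F^*_{t,u} is the coordinate of P^* along the unit normal, near 0. *)
Definition isMovingFrameMap (tau F : R -> R) : Prop :=
  \forall y \near (0 : R),
    poincareExt tau y =
      F y *: ((enorm (perp baseVelocity))^-1 *: perp baseVelocity).

End PoincareMap.

(* Main.v *)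
Require Import Defs.
From mathcomp Require Import all_boot all_order all_algebra.
From mathcomp Require Import all_classical all_reals all_analysis.
From mathcomp Require Import ring.

Import Order.TTheory GRing.Theory Num.Theory.
Import numFieldNormedType.Exports.

Local Open Scope classical_set_scope.
Local Open Scope ring_scope.

(* Pairing the relation defining F with the normal z = v^perp to v = A e^{tA} u
   gives |v|^2 F(y) = y p(tau y + t) + q(tau y + t) - q(t) near 0, with
   p(s) = <e^{sA} (Au)^perp, z> and q(s) = <e^{sA} u, z>.  Differentiating twice
   at 0 leaves 2 p'(t) tau' + q''(t) tau'^2 + q'(t) tau'', and
   q'(t) = <v, v^perp> = 0.  Invertibility of A and of e^{tA} gives v <> 0. *)

(** A neighbourhood of a matrix contains a product of neighbourhoods of its entries, and a filter is
    closed under the finite intersection over these entries. *)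
Lemma cvg_mx {T : Type} {R : topologicalType} {m n : nat}
    (F : set_system T) (f : T -> 'M[R]_(m, n)) (l : 'M[R]_(m, n)) : Filter F ->
  (forall i j, f x i j @[x --> F] --> l i j) -> f @ F --> l.
Proof.
move=> FF fl B [P Pl PB]; apply: filterS.
  by move=> x Px; apply: PB; exact: Px.
apply: filter_forall => i; apply: filter_forall => j.
exact: (fl i j _ (Pl i j)).
Qed.

(** * Entrywise power series of the matrix exponential *)

Section MatrixExponential.
Context {R : realType} {n : nat}.
Implicit Types (A B : 'M[R]_n.+1) (s : R).

(** Each [|A l j|] is at most the absolute sum of row [l], so every further factor [A] costs at most
    the sum of all absolute entries. *)
Lemma norm_exprmx_le A k i j :
  `|(A ^+ k) i j| <= (\sum_a \sum_b `|A a b|) ^+ k.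
Proof.
elim: k j => [|k IH] j.
  by rewrite !expr0 mxE; case: eqP => _; rewrite ?normr1 ?normr0.
rewrite exprSr mxE (le_trans (ler_norm_sum _ _ _))// exprSr mulr_sumr.
apply: ler_sum => l _; rewrite normrM ler_pM// (bigD1 j)//= lerDl.
by apply: sumr_ge0.
Qed.

(** Coefficients in s of the entry (i, j) of A^m e^{sA}; the shift [m] makes the family closed under
    termwise differentiation. *)
Definition expmx_coeff A m i j : R^nat :=
  fun k => (k`!%:R)^-1 * (A ^+ (m + k)) i j.

(** Absolute convergence, by comparison with M^m times the scalar exponential series at M|s|. *)
Lemma is_cvg_expmx_coeff A m i j s : cvgn (pseries (expmx_coeff A m i j) s).
Proof.
set M := \sum_a \sum_b `|A a b|.
have M0 : 0 <= M by apply: sumr_ge0 => a _; exact: sumr_ge0.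
apply: normed_cvg.
apply: (@series_le_cvg _ _ (M ^+ m *: exp_coeff (M * `|s|))) => [k|k|k|].
- exact: normr_ge0.
- by rewrite mulr_ge0 ?exprn_ge0// exp_coeff_ge0// mulr_ge0.
- rewrite /= /expmx_coeff normrM normrM normrX ger0_norm ?invr_ge0//.
  rewrite (_ : (_ *: _) k = k`!%:R^-1 * M ^+ (m + k) * `|s| ^+ k).
    by rewrite ler_wpM2r ?exprn_ge0// ler_wpM2l ?invr_ge0// norm_exprmx_le.
  change (M ^+ m * ((M * `|s|) ^+ k / k`!%:R) =
    k`!%:R^-1 * M ^+ (m + k) * `|s| ^+ k).
  by rewrite exprMn exprD; ring.
- exact/is_cvg_seriesZ/is_cvg_series_exp_coeff.
Qed.

(** The factor k + 1 produced by differentiation cancels against (k + 1)!. *)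
Lemma pseries_diffs_expmx_coeff A m i j :
  pseries_diffs (expmx_coeff A m i j) = expmx_coeff A m.+1 i j.
Proof.
apply/funext => k; rewrite /pseries_diffs /expmx_coeff mulrA factS natrM invfM.
by rewrite mulrA mulfV ?mul1r ?pnatr_eq0// addSnnS.
Qed.

Lemma expmxE A s i j :
  expmx (s *: A) i j = limn (pseries (expmx_coeff A 0 i j) s).
Proof.
rewrite /expmx.
suff -> : lim (series (fun k => (k`!%:R)^-1 *: (s *: A) ^+ k) @ \oo) =
  \matrix_(i, j) limn (pseries (expmx_coeff A 0 i j) s) by rewrite mxE.
apply: (cvg_lim (@norm_hausdorff _ _)); apply: cvg_mx => {}i {}j.
rewrite mxE (_ : (fun N => _) = pseries (expmx_coeff A 0 i j) s).
  exact: is_cvg_expmx_coeff.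
apply/funext => N; rewrite /pseries /series /= summxE; apply: eq_bigr => k _.
by rewrite exprZn !mxE /expmx_coeff mulrCA mulrC.
Qed.

(** Multiplication by [A] is a finite combination of convergent entry series, and A A^k = A^{k+1}.
    The next lemma uses A^k A = A^{k+1} and reaches the same series, whence [A] commutes with
    e^{sA}. *)
Lemma mulmx_expmxE A s i j :
  (A *m expmx (s *: A)) i j = limn (pseries (expmx_coeff A 1 i j) s).
Proof.
apply/esym/cvg_lim => //; rewrite mxE.
rewrite (_ : pseries _ _ =
  (fun N => \sum_l A i l * pseries (expmx_coeff A 0 l j) s N)).
  apply: cvg_big => [|l _]; first exact: add_continuous.
  by apply: cvgMl_tmp; rewrite expmxE; exact: is_cvg_expmx_coeff.
apply/funext => N; rewrite /pseries /series /=.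
under [RHS]eq_bigr do rewrite mulr_sumr.
rewrite exchange_big/=; apply: eq_bigr => k _.
rewrite /expmx_coeff add1n exprS mxE mulr_sumr mulr_suml.
by apply: eq_bigr => l _; rewrite add0n; ring.
Qed.

Lemma expmx_mulmxE A s i j :
  (expmx (s *: A) *m A) i j = limn (pseries (expmx_coeff A 1 i j) s).
Proof.
apply/esym/cvg_lim => //; rewrite mxE.
rewrite (_ : pseries _ _ =
  (fun N => \sum_l pseries (expmx_coeff A 0 i l) s N * A l j)).
  apply: cvg_big => [|l _]; first exact: add_continuous.
  by apply: cvgMr_tmp; rewrite expmxE; exact: is_cvg_expmx_coeff.
apply/funext => N; rewrite /pseries /series /=.
under [RHS]eq_bigr do rewrite mulr_suml.
rewrite exchange_big/=; apply: eq_bigr => k _.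
rewrite /expmx_coeff add1n exprSr mxE mulr_sumr mulr_suml.
by apply: eq_bigr => l _; rewrite add0n; ring.
Qed.

Lemma expmx_comm A s : A *m expmx (s *: A) = expmx (s *: A) *m A.
Proof. by apply/matrixP => i j; rewrite mulmx_expmxE expmx_mulmxE. Qed.

Lemma expmx0 : expmx 0 = 1 :> 'M[R]_n.+1.
Proof.
(* The empty partial sum is 0; after a shift by one every partial sum contains the term k = 0 and
   equals 1. *)
apply: (cvg_lim (@norm_hausdorff _ _)); rewrite -cvg_shiftS /=.
rewrite (_ : (fun N => _) = cst 1); first exact: cvg_cst.
apply/funext => N; rewrite /series /= big_nat_recl// big1 ?addr0.
  by rewrite expr0 fact0 invr1 scale1r.
by move=> k _; rewrite exprS mul0r scaler0.
Qed.

Lemma is_derive_expmx A s i j :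
  is_derive s (1 : R) (fun x => expmx (x *: A) i j) ((A *m expmx (s *: A)) i j).
Proof.
rewrite mulmx_expmxE -pseries_diffs_expmx_coeff.
rewrite (_ : (fun x => _) = fun x => limn (pseries (expmx_coeff A 0 i j) x)).
  (* Termwise differentiation at s asks for convergence at some point of larger modulus; |s| + 1 is
     one. *)
  apply: (@pseries_snd_diffs _ _ (`|s| + 1));
    rewrite ?pseries_diffs_expmx_coeff; try exact: is_cvg_expmx_coeff.
  by rewrite [ltRHS]ger0_norm ?addr_ge0// ltrDl.
by apply/funext => x; rewrite expmxE.
Qed.

(** The product has zero derivative in s, so it keeps its value at s = 0. *)
Lemma expmxN_mul A s : expmx (- s *: A) *m expmx (s *: A) = 1%:M.
Proof.
apply/matrixP => i j.
transitivity ((expmx (- 0 *: A) *m expmx (0 *: A)) i j); last first.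
  by rewrite oppr0 scale0r expmx0 mulmx1.
apply: (@is_derive_0_is_cst _
  (fun s => (expmx (- s *: A) *m expmx (s *: A)) i j)) => {}s.
rewrite (_ : (fun s => _) = \sum_l
    (((fun x => expmx (x *: A) i l) \o -%R) * (fun x => expmx (x *: A) l j))).
  have dE l : is_derive s (1 : R)
      (((fun x => expmx (x *: A) i l) \o -%R) * (fun x => expmx (x *: A) l j))
      (expmx (- s *: A) i l * (A *m expmx (s *: A)) l j
       - (expmx (- s *: A) *m A) i l * expmx (s *: A) l j).
    have [dN dP] := (is_derive_expmx A (- s) i l, is_derive_expmx A s l j).
    apply: (is_derive_eq (is_deriveM
      (is_derive1_comp dN (is_deriveNid _ _)) dP)).
    (* Commutation places [A] between the two exponentials, so that both sums cancel by
       associativity. *)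
    by rewrite -(expmx_comm A (- s)) /GRing.scale /=; ring.
  apply: is_derive_eq (is_derive_sum dE) _.
  have := mulmxA (expmx (- s *: A)) A (expmx (s *: A)).
  move=> /matrixP/(_ i j); rewrite !mxE sumrB => ->; exact: subrr.
by apply/funext => x; rewrite mxE fct_sumE.
Qed.

End MatrixExponential.

(** * Euclidean pairing and rotation in the plane *)

Section PlaneGeometry.
Context {R : realType}.
Implicit Types (v w z : 'cV[R]_2) (a : R).

Lemma dotE v w : dot v w = v 0 0 * w 0 0 + v 1 0 * w 1 0.
Proof.
by rewrite /dot !big_ord_recl big_ord0 addr0 (_ : lift _ _ = 1)//; exact/val_inj.
Qed.

Lemma dotDl v w z : dot (v + w) z = dot v z + dot w z.
Proof. by rewrite !dotE !mxE; ring. Qed.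

Lemma dotZl a v z : dot (a *: v) z = a * dot v z.
Proof. by rewrite !dotE !mxE; ring. Qed.

Lemma dot_mulmxl (M : 'M[R]_2) v z : dot (M *m v) z = dot v (M^T *m z).
Proof.
have dot_mx x y : dot x y = (x^T *m y) 0 0.
  by rewrite /dot mxE; apply: eq_bigr => i _; rewrite mxE.
by rewrite !dot_mx trmx_mul mulmxA.
Qed.

Lemma dot_perp v : dot v (perp v) = 0.
Proof. by rewrite dotE !mxE /=; ring. Qed.

Lemma dot_perp_perp v : dot (perp v) (perp v) = dot v v.
Proof. by rewrite !dotE !mxE /=; ring. Qed.

Lemma enorm_perp v : enorm (perp v) = enorm v.
Proof. by rewrite /enorm dot_perp_perp. Qed.

Lemma dot_ge0 v : 0 <= dot v v.
Proof. by rewrite dotE addr_ge0// -expr2 sqr_ge0. Qed.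

Lemma dot_eq0 v : (dot v v == 0) = (v == 0).
Proof.
apply/eqP/eqP => [|->]; last by rewrite dotE !mxE; ring.
rewrite dotE -!expr2 => /eqP; rewrite paddr_eq0 ?sqr_ge0// !sqrf_eq0.
move=> /andP[/eqP v0 /eqP v1]; apply/matrixP => i j; rewrite ord1 mxE.
case: i => -[|[|//]] ilt; [rewrite -[RHS]v0|rewrite -[RHS]v1];
  by congr (v _ _); exact/val_inj.
Qed.

Lemma sqr_enorm v : enorm v ^+ 2 = dot v v.
Proof. by rewrite sqr_sqrtr ?dot_ge0. Qed.

End PlaneGeometry.

(** * Derivatives along the linear flow *)

Section LinearFlow.
Context {R : realType}.
Context (A : 'M[R]_2).
Implicit Types (w z u : 'cV[R]_2) (s t : R).

(** The pairing is a fixed linear combination of the entries of e^{sA}. With [M] on the left,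
    differentiation only replaces [M] by [M *m A], so the lemma can be iterated. *)
Lemma is_derive_dot_flow (M : 'M[R]_2) w z s :
  is_derive s (1 : R) (fun x => dot (M *m flow A x *m w) z)
    (dot (M *m A *m flow A s *m w) z).
Proof.
pose y := M^T *m z.
have dotM (N : 'M[R]_2) : dot (M *m N *m w) z =
    \sum_(i < 2) \sum_(j < 2) (w j 0 * y i 0) * N i j.
  rewrite -mulmxA dot_mulmxl /dot; apply: eq_bigr => i _; rewrite -/y mxE.
  by rewrite mulr_suml; apply: eq_bigr => j _; ring.
rewrite -[M *m A *m _]mulmxA dotM.
rewrite (_ : (fun x => _) = \sum_(i < 2) \sum_(j < 2)
    ((w j 0 * y i 0) \*: (fun x => flow A x i j))).
  apply: is_derive_sum => i; apply: is_derive_sum => j.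
  exact/is_deriveZ/is_derive_expmx.
apply/funext => x; rewrite dotM fct_sumE; apply: eq_bigr => i _.
by rewrite fct_sumE.
Qed.

Lemma baseVelocity_neq0 t u : A \in unitmx -> u != 0 ->
  baseVelocity A t u != 0.
Proof.
move=> uA; apply: contra_neq; rewrite /baseVelocity -mulmxA => Au0.
have : flow A t *m u = 0 by rewrite -(mulKmx uA (_ *m u)) Au0 mulmx0.
move=> /(congr1 (mulmx (expmx (- t *: A)))).
by rewrite mulmxA expmxN_mul mul1mx mulmx0.
Qed.

End LinearFlow.

(** * Calculus of c (y p(tau + t) + q(tau + t) - q(t)) for scalar p and q *)

Section SecondDerivative.
Context {R : realType}.
Context {p p1 p2 q q1 q2 tau F : R -> R} {t c : R}.
Context (dp : forall s : R, is_derive s 1 p (p1 s))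
  (dp1 : forall s : R, is_derive s 1 p1 (p2 s))
  (dq : forall s : R, is_derive s 1 q (q1 s))
  (dq1 : forall s : R, is_derive s 1 q1 (q2 s))
  (tau0 : tau 0 = 0)
  (dtau : \forall y \near (0 : R), derivable tau y 1)
  (ddtau : derivable (tau^`())%classic 0 1)
  (FE : \forall y \near (0 : R),
    F y = c * (y * p (tau y + t) + (q (tau y + t) - q t))).

Let is_derive_tauD (y : R) : derivable tau y 1 ->
  is_derive y (1 : R) (fun x => tau x + t) (tau^`()%classic y).
Proof.
move=> /derivableP dy; rewrite derive1E.
have -> : (fun x => tau x + t) = tau + cst t by [].
by apply: (is_derive_eq (is_deriveD dy (is_derive_cst _ _ _))); rewrite addr0.
Qed.

Lemma is_derive1_movingFrame : \forall y \near (0 : R), is_derive y (1 : R) F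
  (c * (p (tau y + t)
        + (y * p1 (tau y + t) + q1 (tau y + t)) * tau^`()%classic y)).
Proof.
(* The formula for [F] must hold on a neighbourhood of each [y] near 0, not only at [y], for it to
   determine the derivative there. *)
have FnE := near_join FE.
near=> y.
have dty : is_derive y (1 : R) (fun x => tau x + t) (tau^`()%classic y).
  by apply: is_derive_tauD; near: y.
have did : is_derive y (1 : R) (@id R) 1 by exact: is_derive_id.
have dcst : is_derive y (1 : R) (cst (q t)) 0 by exact: is_derive_cst.
have H := is_deriveZ c (is_deriveD
  (is_deriveM did (is_derive1_comp (dp _) dty))
  (is_deriveB (is_derive1_comp (dq _) dty) dcst)).
apply: (near_eq_is_derive _ (is_derive_eq H _)); last first.
  by rewrite /GRing.scale /=; ring.
have : \near y, F y = c * (y * p (tau y + t) + (q (tau y + t) - q t)).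
  by near: y.
by apply: filterS => x ->.
Unshelve. all: by end_near. Qed.

(** The factor 2 collects one p' tau' from p(tau + t) and one from the derivative of y in y p'(tau +
    t) tau'; the remaining terms in p carry a factor y and vanish at 0. *)
Lemma is_derive2_movingFrame : is_derive (0 : R) (1 : R) (F^`())%classic
  (c * (2 * p1 t * tau^`()%classic 0 + q2 t * tau^`()%classic 0 ^+ 2
        + q1 t * tau^`(2)%classic 0)).
Proof.
have dt0 := is_derive_tauD _ (nbhs_singleton dtau).
have /derivableP ddt0 := ddtau.
have did : is_derive 0 (1 : R) (@id R) 1 by exact: is_derive_id.
have H := is_deriveZ c (is_deriveD (is_derive1_comp (dp _) dt0)
  (is_deriveM (is_deriveD
    (is_deriveM did (is_derive1_comp (dp1 _) dt0))
    (is_derive1_comp (dq1 _) dt0)) ddt0)).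
apply: (near_eq_is_derive _ (is_derive_eq H _)); last first.
  have -> : tau^`(2)%classic 0 = 'D_1 (tau^`())%classic 0.
    by rewrite derive1nS derive1n1 derive1E.
  rewrite /GRing.scale /= !fctE /= tau0 add0r. ring.
by apply: filterS is_derive1_movingFrame => y dF; rewrite derive1E derive_val.
Qed.

End SecondDerivative.

(** * Projection onto the normal and evaluation at 0 *)

Theorem mainTheorem3 (R : realType) (A : 'M[R]_2) (u : 'cV[R]_2) (t : R)
    (tau F : R -> R) (hA : A \in unitmx) (hu : enorm u = 1)
    (htau : isTimeFunction A t u tau) (hF : isMovingFrameMap A t u tau F) :
  [/\ \forall y \near (0 : R), derivable F y 1,
      derivable (F^`())%classic 0 1 &
      (F^`(2))%classic 0 =
        2 * (dot (A *m expmx (t *: A) *m perp (A *m u))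
                 (perp (A *m expmx (t *: A) *m u))
             / dot (A *m expmx (t *: A) *m u) (A *m expmx (t *: A) *m u))
          * (tau^`())%classic 0
        + dot (A ^+ 2 *m expmx (t *: A) *m u) (perp (A *m expmx (t *: A) *m u))
             / dot (A *m expmx (t *: A) *m u) (A *m expmx (t *: A) *m u)
          * ((tau^`())%classic 0) ^+ 2].
Proof.
rewrite -/(flow A t) -/(baseVelocity A t u).
set v := baseVelocity A t u; set w := perp (A *m u); set z := perp v.
have u0 : u != 0.
  apply: contraPneq hu => ->; rewrite /enorm dotE !mxE mulr0 addr0 sqrtr0.
  by move=> /esym/eqP; rewrite oner_eq0.
have vv0 : dot v v != 0 by rewrite dot_eq0; exact: baseVelocity_neq0.
have v0 : enorm v != 0 by rewrite -(@sqrf_eq0 R) sqr_enorm.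
(* One family serves for p ([x = w]) and q ([x = u]): [M] equal to 1, A, A^2 gives the function and
   its first two derivatives. *)
pose p (M : 'M[R]_2) x s := dot (M *m flow A s *m x) z.
have dp M x s : is_derive s (1 : R) (p M x) (p (M *m A) x s).
  exact: is_derive_dot_flow.
have [tau0 dtau _] := htau.
(* Smoothness of [tau] enters at order 0 near 0, then at order 1 at 0 itself. *)
have dtau0 : \forall y \near (0 : R), derivable tau y 1.
  by apply: filterS dtau => y /(_ 0%N).
have ddtau : derivable (tau^`())%classic 0 1.
  by have := nbhs_singleton dtau 1%N; rewrite derive1n1.
have FE : \forall y \near (0 : R), F y = (dot v v)^-1 *
    (y * p 1%:M w (tau y + t) + (p 1%:M u (tau y + t) - p 1%:M u t)).
  apply: filterS hF => y /(congr1 (fun x => dot x z)).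
  rewrite /poincareExt -/v -/z -/w enorm_perp dotDl !dotZl dot_perp_perp.
  rewrite -scalemxAr dotZl dotDl -[- (_ *m u)]scaleN1r dotZl /p !mul1mx.
  rewrite -sqr_enorm => Fy.
  (* Pairing the unit normal with [z] gives |v|, so [Fy] determines |v| F(y); a further division by
     |v| yields the constant 1/|v|^2. *)
  have -> : F y = (enorm v)^-1 * (F y * ((enorm v)^-1 * enorm v ^+ 2)).
    by field.
  by rewrite -Fy; field.
have d1 := is_derive1_movingFrame (dp 1%:M w) (dp 1%:M u) dtau0 FE.
have d2 := is_derive2_movingFrame (dp 1%:M w)
  (dp _ w) (dp 1%:M u) (dp _ u) tau0 dtau0 ddtau FE.
split.
- by apply: filterS d1 => y [].
- by case: d2.
- rewrite derive1nS derive1n1 derive1E; case: d2 => _ ->.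
  (* The coefficient of tau''(0) folds to [dot v (perp v)], which [dot_perp] sends to 0. *)
  rewrite /p !mul1mx -/(baseVelocity A t u) -/v dot_perp -[A ^+ 2]/(A *m A).
  by field.
Qed.
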